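(* Let $F$ be an algebraic function field of one variable with full constant field $\mathbb{F}_q$ and genus $g=1$, and let $\mathcal{P}=\{P_0,\dots,P_{n-1}\}$ be the set of all rational (degree-one) places of $F$, where $n=|\mathcal{P}|\ge 5$. Let $\mathcal{O}_{\mathcal{P}}^*$ be the group of nonzero $f\in F$ whose divisor has support contained in $\mathcal{P}$, let $\phi_{\mathcal{P}}:\mathcal{O}_{\mathcal{P}}^*\to\mathbb{Z}^n$, $\phi_{\mathcal{P}}(f)=(v_0(f),\dots,v_{n-1}(f))$, where $v_i$ is the normalized discrete valuation of $P_i$, and let $L_{\mathcal{P}}=\phi_{\mathcal{P}}(\mathcal{O}_{\mathcal{P}}^* )\subset\mathbb{Z}^n$. Then $L_{\mathcal{P}}$ is generated (as a group) by its minimal vectors, and hence $L_{\mathcal{P}}$ is well-rounded.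
   Context: $L_{\mathcal{P}}$ is a lattice contained in $A_{n-1}=\{x\in\mathbb{Z}^n:\sum_i x_i=0\}$, of rank $n-1$. Norms are Euclidean. The minimal vectors of a lattice $L$ are its nonzero vectors of smallest Euclidean norm; $L$ is well-rounded if its set of minimal vectors contains $\mathrm{rank}(L)$ linearly independent vectors. *)

(* Defs.v *)
From HB Require Import structures.
From mathcomp Require Import all_boot all_order all_algebra.
From mathcomp Require Import boolp classical_sets reals.
From mathcomp.multinomials Require Import freeg.

Set Implicit Arguments.
Unset Strict Implicit.
Unset Printing Implicit Defensive.

Import Order.TTheory GRing.Theory Num.Theory.

Local Open Scope classical_set_scope.
Local Open Scope ring_scope.

(* An extension F / K is an embedding iota : K -> F; the terminology follows
   Stichtenoth, "Algebraic Function Fields and Codes", Chapter 1. *)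
Section FunctionField.
Variables (K F : fieldType) (iota : {rmorphism K -> F}).

Definition rational_subfield (x : F) : set F :=
  [set y | exists p q : {poly K},
     (map_poly iota q).[x] != 0 /\
     y = (map_poly iota p).[x] / (map_poly iota q).[x]].

Definition finite_over_rational_subfield (x : F) : Prop :=
  exists (m : nat) (b : 'I_m -> F), forall y : F,
    exists c : 'I_m -> F,
      (forall i, rational_subfield x (c i)) /\ y = \sum_i c i * b i.

Definition function_field : Prop :=
  exists x : F, ~ algebraicOver iota x /\ finite_over_rational_subfield x.

Definition full_constant_field : Prop :=
  forall y : F, algebraicOver iota y -> exists c : K, y = iota c.

(* dim_K (U / W) for K-subspaces W <= U of F; it is 0 by convention when the
   quotient is infinite-dimensional, which never happens below when F / K is a
   function field. *)
Definition basis_mod (U W : set F) (n : nat) (b : 'I_n -> F) : Prop :=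
  [/\ forall i, U (b i),
      forall c : 'I_n -> K, W (\sum_i iota (c i) * b i) -> forall i, c i = 0
    & forall z, U z -> exists c : 'I_n -> K, W (z - \sum_i iota (c i) * b i)].

Definition dim_mod (U W : set F) : nat :=
  xget 0%N [set n | exists b : 'I_n -> F, basis_mod U W b].

Definition valuation_ring (O : {pred F}) : Prop :=
  [/\ subring_closed O,
      forall c : K, iota c \in O,
      exists2 z, z \in O & forall c : K, z != iota c,
      exists z, z \notin O
    & forall z, z != 0 -> z \in O \/ z^-1 \in O].

(* A place is the maximal ideal of a valuation ring of F / K; as the ring and
   its maximal ideal determine each other, a place is stored by its ring. *)
Record place : Type := Place {
  place_ring : {pred F};
  place_ringP : valuation_ring place_ring
}.

HB.instance Definition _ := gen_eqMixin place.
HB.instance Definition _ := gen_choiceMixin place.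

Definition place_unit (P : place) (z : F) : bool :=
  [&& z != 0, z \in place_ring P & z^-1 \in place_ring P].

Definition place_ideal (P : place) (z : F) : bool :=
  (z \in place_ring P) && ~~ place_unit P z.

Definition prime_element (P : place) (t : F) : Prop :=
  forall z, place_ideal P z <-> exists2 y, y \in place_ring P & z = t * y.

(* v_P(z) is the exponent m in z = t^m u with t a prime element and u a unit of
   O_P, for z != 0. No m qualifies for z = 0, and v_P(0) is then 0 instead of
   infinity: this value is never used. *)
Definition valuation (P : place) (z : F) : int :=
  xget 0 [set m : int | exists t u,
            [/\ prime_element P t, place_unit P u & z = t ^ m * u]].

Definition place_degree (P : place) : nat :=
  dim_mod [set z | z \in place_ring P] [set z | place_ideal P z].

Definition rational_place (P : place) : Prop := place_degree P = 1%N.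

Definition divisor : Type := {freeg place}.

Definition divisor_degree (D : divisor) : int :=
  \sum_(P <- dom D) coeff P D * (place_degree P)%:Z.

Definition riemann_roch_space (D : divisor) : set F :=
  [set f | f = 0 \/ forall P : place, - coeff P D <= valuation P f].

Definition riemann_roch_dim (D : divisor) : nat :=
  dim_mod (riemann_roch_space D) [set 0].

(* g = max { deg D - l(D) + 1 } over all divisors D. *)
Definition has_genus (g : nat) : Prop :=
  (exists D : divisor,
     divisor_degree D - (riemann_roch_dim D)%:Z + 1 = g%:Z) /\
  (forall D : divisor,
     divisor_degree D - (riemann_roch_dim D)%:Z + 1 <= g%:Z).

Section PlaceFamily.
Variables (n : nat) (P : 'I_n -> place).

Definition enumerates_rational_places : Prop :=
  injective P /\ (forall Q : place, rational_place Q <-> exists i, Q = P i).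

Definition S_units : set F :=
  [set f | f != 0 /\
     forall Q : place, valuation Q f != 0 -> exists i, Q = P i].

Definition valuation_vector (f : F) : 'rV[int]_n :=
  \row_i valuation (P i) f.

Definition unit_lattice : set 'rV[int]_n := valuation_vector @` S_units.

End PlaceFamily.
End FunctionField.

Section Lattice.
Variables (R : realType) (n : nat).

Definition euclidean_norm (x : 'rV[int]_n) : R :=
  Num.sqrt (\sum_i ((x 0 i)%:~R) ^+ 2).

Definition minimal_vectors (L : set 'rV[int]_n) : set 'rV[int]_n :=
  [set x | [/\ L x, x != 0
    & forall y, L y -> y != 0 -> euclidean_norm x <= euclidean_norm y]].

Definition generated_subgroup (S : set 'rV[int]_n) : set 'rV[int]_n :=
  [set x | forall H : {pred 'rV[int]_n},
     zmod_closed H -> (forall y, S y -> y \in H) -> x \in H].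

(* S contains m vectors (the rows of B) that are linearly independent in R^n. *)
Definition has_independent (S : set 'rV[int]_n) (m : nat) : Prop :=
  exists B : 'M[int]_(m, n),
    (forall i, S (row i B)) /\ row_free (map_mx intr B : 'M[R]_(m, n)).

Definition has_rank (L : set 'rV[int]_n) (r : nat) : Prop :=
  has_independent L r /\ (forall m, has_independent L m -> (m <= r)%N).

Definition well_rounded (L : set 'rV[int]_n) : Prop :=
  exists2 r, has_rank L r & has_independent (minimal_vectors L) r.

End Lattice.

(* Main.v *)
(* Let O be the ring of a place and x a nonzero element of its maximal ideal. A
   relation over K[x] between elements of O yields one over K modulo x, so O / xO
   is finite-dimensional over K; this makes every place discrete and of finite
   positive degree. Genus one provides Riemann's inequality l(D) >= deg D. If the
   divisor of h is at least C then multiplication by h^k embeds L(kC) into L(0),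
   whence deg C <= 0: principal divisors have degree 0, and every nonzero f in
   L(D) has an effective residual divisor (f) + D of degree deg D. Applied to
   D = P_a + P_b - P_c this gives, for all a, b, c, some d such that
   e_a + e_b - e_c - e_d lies in the unit lattice; and e_a - e_b never lies in it
   for a <> b, as otherwise l(m P_b) > m for all m. Such a lattice has minimal
   squared norm 4 and, for n >= 5, is generated by the vectors
   e_a + e_b - e_c - e_d with a, b, c, d distinct. *)

From HB Require Import structures.
Require Import Defs.
From mathcomp Require Import all_boot all_order all_algebra.
From mathcomp Require Import boolp classical_sets reals.
From mathcomp.multinomials Require Import freeg.
From mathcomp Require Import zify.

Set Implicit Arguments.
Unset Strict Implicit.
Unset Printing Implicit Defensive.

Import Order.TTheory GRing.Theory Num.Theory.

Local Open Scope classical_set_scope.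
Local Open Scope ring_scope.

(** The coefficient matrix has rows indexed by [T] and rank at most [#|J|], so its left kernel
    contains a nonzero row. *)
Lemma exists_relation (K : fieldType) (T J : finType) (a : T -> J -> K) :
  (#|J| < #|T|)%N ->
  exists2 c : T -> K, exists t, c t != 0 & forall j, \sum_t c t * a t j = 0.
Proof.
move=> ltJT; pose M := \matrix_(i < #|T|, j < #|J|) a (enum_val i) (enum_val j).
have: kermx M != 0.
  rewrite kermx_eq0 /row_free ltn_eqF //.
  exact: leq_ltn_trans (rank_leq_col _) ltJT.
case/rowV0Pn=> v /sub_kermxP vM v0.
exists (fun t => v 0 (enum_rank t)).
  case/rV0Pn: v0 => i vi; exists (enum_val i); by rewrite enum_valK.
move=> j; have := congr1 (fun A : 'rV_#|J| => A 0 (enum_rank j)) vM.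
rewrite !mxE => E; rewrite -[RHS]E.
rewrite (reindex (@enum_val T T)) /=; last first.
  by exists enum_rank => x _; rewrite ?enum_valK ?enum_rankK.
by apply: eq_bigr => i _; rewrite mxE enum_valK enum_rankK.
Qed.

(** * Lattices generated by their minimal vectors *)

Section Generated.
Variables (R : realType) (n : nat).
Implicit Types (S L : set 'rV[int]_n).

Lemma generated_subgroup_sub S L :
  (forall x, S x -> L x) -> zmod_closed [pred x | `[< L x >]] ->
  forall x, generated_subgroup S x -> L x.
Proof.
move=> SL Lz x /(_ [pred x | `[< L x >]] Lz) Lx; apply/asboolP.
by apply: Lx => y /SL Ly; apply/asboolP.
Qed.

Lemma generated_subgroup_zmod S :
  zmod_closed [pred x | `[< generated_subgroup S x >]].
Proof.
split=> [|x y]; first by apply/asboolP => H [].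
move=> /asboolP Sx /asboolP Sy; apply/asboolP => H Hz SH.
by have [_ HB] := Hz; apply: HB; [apply: Sx | apply: Sy].
Qed.

Lemma generated_subgroup_mem S x : S x -> generated_subgroup S x.
Proof. by move=> Sx H _; apply. Qed.

Lemma has_independent0 S : has_independent R S 0.
Proof. by exists 0; split; [case | rewrite /row_free flatmx0 mxrank0]. Qed.

Lemma has_independent_le S m : has_independent R S m -> (m <= n)%N.
Proof. by case=> B [_ /eqP <-]; apply: rank_leq_col. Qed.

(** An independent family in [S] of maximal size spans [S] over the reals, hence also the subgroup
    generated by [S], so its size is the rank of [L]. With [S] the minimal vectors this turns
    generation into well-roundedness. *)
Lemma has_rank_generated S L : (forall x, S x -> L x) ->
  (forall x, L x -> generated_subgroup S x) ->
  exists2 r, has_rank R L r & has_independent R S r.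
Proof.
move=> SL LS.
pose p m := `[< has_independent R S m >].
have p0 : exists m, p m by exists 0%N; apply/asboolP; apply: has_independent0.
have pn m : p m -> (m <= n)%N by move/asboolP; apply: has_independent_le.
case: (ex_maxnP p0 pn) => r /asboolP Sr rmax; exists r => //; split.
  by case: Sr => B [SB fB]; exists B; split=> // i; apply/SL/SB.
move=> m [C [LC fC]]; case: Sr => B [SB fB].
have span x : L x -> (map_mx intr x <= (map_mx intr B : 'M[R]_(r, n)))%MS.
  move=> /LS /(_ [pred x | (map_mx intr x <= (map_mx intr B : 'M[R]_(r, n)))%MS]).
  apply.
    split=> [|y z]; rewrite !inE ?map_mx0 ?sub0mx // => yB zB.
    by rewrite map_mxB addmx_sub // eqmx_opp.
  move=> y Sy; rewrite inE; apply/negP => /negP yB.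
  (* A vector of [S] outside the row space of [B] could be adjoined to [B], against the maximality
     of [r]. *)
  suff /asboolP/rmax : has_independent R S (1 + r)%N by rewrite ltnn.
  exists (col_mx y B); split=> [i|].
    case: (split_ordP i) => j ->.
      rewrite rowKu; suff -> : row j y = y by [].
      by apply/rowP=> k; rewrite mxE (ord1 j).
    by rewrite rowKd; apply: SB.
  rewrite map_col_mx -row_leq_rank.
  have := mxrank_sum_cap (map_mx intr y : 'rV[R]_n) (map_mx intr B).
  set U := (_ + _)%MS; set V := (_ :&: _)%MS.
  have y0 : map_mx intr y != 0 :> 'rV[R]_n.
    by apply: contraNneq yB => ->; rewrite sub0mx.
  have V0 : \rank V = 0%N.
    apply/eqP; rewrite mxrank_eq0; apply/eqP/row_matrixP=> i; rewrite row0.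
    apply/eqP; rewrite -submx0; apply/rV_subP => v.
    move/submx_trans/(_ (row_sub _ _)).
    rewrite sub_capmx => /andP[/sub_rVP[a ->]].
    have [->|a0] := eqVneq a 0; first by rewrite scale0r => _; apply: sub0mx.
    by rewrite eqmx_scale // (negbTE yB).
  by rewrite V0 addn0 (eqP fB) rank_rV y0 /U addsmxE => ->.
have CB : (map_mx intr C <= (map_mx intr B : 'M[R]_(r, n)))%MS.
  by apply/row_subP => i; rewrite -map_row; apply: span; apply: LC.
by have := mxrankS CB; rewrite (eqP fC) (eqP fB).
Qed.

End Generated.

(** Entrywise, the Kronecker deltas are replaced by arbitrary integers, so the identity must hold
    formally in the unit vectors. *)
Local Ltac row_lia :=
  let i := fresh in apply/rowP => i; rewrite !mxE;
  repeat match goal with |- context [GRing.natmul ?x ?k] =>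
    generalize (GRing.natmul x k) end; clear; lia.

(** * Lattices closed under a group law on the coordinate indices *)

Section QuadLattice.
Variables (R : realType) (n : nat) (L : set 'rV[int]_n).

Local Notation e i := (delta_mx 0 i : 'rV[int]_n).
(** For the unit lattice, [L (quad a b c d)] says that a + b = c + d in the group law on the
    rational places. *)
Definition quad (a b c d : 'I_n) : 'rV[int]_n := e a + e b - e c - e d.

Hypotheses (n_ge5 : (5 <= n)%N) (Lzmod : zmod_closed [pred x | `[< L x >]]).
Hypothesis L_sum0 : forall x, L x -> \sum_i x 0 i = 0.
Hypothesis L_quad : forall a b c, exists d, L (quad a b c d).
Hypothesis L_inj : forall a b, L (e a - e b) -> a = b.

Let L0 : L 0. Proof. by have [/asboolP] := Lzmod. Qed.
Let LB x y : L x -> L y -> L (x - y).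
Proof.
by have [_ B] := Lzmod; move=> Lx Ly; apply/asboolP/B; apply/asboolP.
Qed.
Let LN x : L x -> L (- x). Proof. by rewrite -sub0r; apply: LB. Qed.
Let LD x y : L x -> L y -> L (x + y).
Proof. by move=> Lx Ly; rewrite -[y]opprK; apply: LB => //; apply: LN. Qed.

Lemma sum_delta (a : 'I_n) : \sum_(i < n) (i == a)%:R = 1 :> int.
Proof.
by rewrite (bigD1 a) //= eqxx big1 ?addr0 // => i /negbTE ->.
Qed.

Let sum_delta4 (a b c d : 'I_n) :
  \sum_(i < n) ((i == a)%:R + (i == b)%:R + (i == c)%:R + (i == d)%:R) = 4%:R :> int.
Proof. by rewrite !big_split /= !sum_delta. Qed.

Let quadE a b c d i : quad a b c d 0 i =
  (i == a)%:R + (i == b)%:R - (i == c)%:R - (i == d)%:R.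
Proof. by rewrite !mxE eqxx. Qed.

Lemma sum0_pos (x : 'rV[int]_n) : \sum_i x 0 i = 0 -> x != 0 -> exists i, 0 < x 0 i.
Proof.
move=> x0 /rV0Pn[j xj]; apply: contrapT => noi.
have xle i : x 0 i <= 0 by rewrite leNgt; apply/negP => xi; apply: noi; exists i.
suff : \sum_i (- x 0 i) != 0 by rewrite sumrN x0 oppr0 eqxx.
rewrite psumr_neq0; last by move=> i _; rewrite oppr_ge0.
by apply/hasP; exists j; rewrite ?mem_index_enum //= oppr_gt0 lt_neqAle xj xle.
Qed.

Lemma sum0_neg (x : 'rV[int]_n) : \sum_i x 0 i = 0 -> x != 0 -> exists i, x 0 i < 0.
Proof.
move=> x0 xn0; have [||i] := @sum0_pos (- x).
- by under eq_bigr do rewrite mxE; rewrite sumrN x0 oppr0.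
- by rewrite oppr_eq0.
by rewrite mxE oppr_gt0 => xi; exists i.
Qed.

(** Pick a positive entry at i and a negative one at j. If either has absolute value at least 2, its
    square is already 4. Otherwise they are 1 and -1, and x - (e_i - e_j) has sum zero and is
    nonzero by [L_inj], so x has a further positive and a further negative entry. *)
Lemma L_norm_ge4 x : L x -> x != 0 -> 4 <= \sum_i x 0 i ^+ 2.
Proof.
move=> Lx xn0; have xs := L_sum0 Lx.
have [i xi] := sum0_pos xs xn0; have [j xj] := sum0_neg xs xn0.
have big k : 4 <= x 0 k ^+ 2 -> 4 <= \sum_i x 0 i ^+ 2.
  move=> xk; rewrite (bigD1 k) //=; apply: le_trans xk _; rewrite lerDl.
  by apply: sumr_ge0 => l _; apply: sqr_ge0.
have [xi2|xi2] := leP 2 (x 0 i); first by apply: (big i); nia.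
have [xj2|xj2] := leP (x 0 j) (- 2); first by apply: (big j); nia.
have xi1 : x 0 i = 1 by lia.
have xj1 : x 0 j = -1 by lia.
have ij : i != j by apply: contraTneq xi => ->; rewrite -leNgt ltW.
pose y := x - (e i - e j).
have yE k : y 0 k = x 0 k - ((k == i)%:R - (k == j)%:R) by rewrite !mxE eqxx.
have yi : y 0 i = 0 by rewrite yE xi1 eqxx (negbTE ij).
have yj : y 0 j = 0 by rewrite yE xj1 eqxx eq_sym (negbTE ij).
have y0 : y != 0.
  apply: contraNneq ij => y0; apply/eqP/L_inj.
  by move/eqP: y0; rewrite subr_eq0 => /eqP <-.
have ys : \sum_i y 0 i = 0.
  by under eq_bigr do rewrite yE; rewrite sumrB xs sumrB !sum_delta subrr.
have [k yk] := sum0_pos ys y0; have [l yl] := sum0_neg ys y0.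
have ki : k != i by apply: contraTneq yk => ->; rewrite yi.
have kj : k != j by apply: contraTneq yk => ->; rewrite yj.
have li : l != i by apply: contraTneq yl => ->; rewrite yi.
have lj : l != j by apply: contraTneq yl => ->; rewrite yj.
have kl : k != l by apply: contraTneq yk => ->; rewrite -leNgt ltW.
have xk : x 0 k = y 0 k by rewrite yE (negbTE ki) (negbTE kj) !subr0.
have xl : x 0 l = y 0 l by rewrite yE (negbTE li) (negbTE lj) !subr0.
have sq_ge1 (z : int) : z != 0 -> 1 <= z ^+ 2.
  by move=> z0; rewrite -gtz0_ge1 exprn_even_gt0.
have yk1 := sq_ge1 _ (lt0r_neq0 yk); have yl1 := sq_ge1 _ (ltr0_neq0 yl).
(* The squares dominate the indicators of the four distinct positions i, j, k, l, whose total is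
   4. *)
rewrite -(sum_delta4 i j k l); apply: ler_sum => t _.
have [->|ti] := eqVneq t i.
  by rewrite (negbTE ij) (eq_sym i) (negbTE ki) (eq_sym i) (negbTE li) xi1.
have [->|tj] := eqVneq t j.
  by rewrite (eq_sym j) (negbTE kj) (eq_sym j) (negbTE lj) xj1.
have [->|tk] := eqVneq t k; first by rewrite (negbTE kl) xk.
have [->|tl] := eqVneq t l; first by rewrite xl.
by rewrite !addr0 sqr_ge0.
Qed.

(** Distinct indices give four entries of absolute value 1, so the squared norm meets the bound of
    [L_norm_ge4]. *)
Lemma quad_minimal a b c d : uniq [:: a; b; c; d] -> L (quad a b c d) ->
  minimal_vectors R L (quad a b c d).
Proof.
rewrite /= !inE !negb_or => /and4P[/and3P[ab ac ad] /andP[bc bd] cd _] Lq.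
have normE (x : 'rV[int]_n) :
    euclidean_norm R x = Num.sqrt (\sum_i x 0 i ^+ 2)%:~R.
  rewrite /euclidean_norm rmorph_sum; congr Num.sqrt.
  by apply: eq_bigr => i _; rewrite rmorphXn.
split=> //.
  apply/rV0Pn; exists a; rewrite quadE eqxx (negbTE ab) (negbTE ac).
  by rewrite (negbTE ad).
move=> y Ly y0; rewrite !normE; apply: ler_wsqrtr; rewrite ler_int.
apply: le_trans (L_norm_ge4 Ly y0); rewrite -(sum_delta4 a b c d).
apply: ler_sum => i _; rewrite quadE.
have [->|ia] := eqVneq i a; first by rewrite (negbTE ab) (negbTE ac) (negbTE ad).
have [->|ib] := eqVneq i b; first by rewrite (negbTE bc) (negbTE bd).
have [->|ic] := eqVneq i c; first by rewrite (negbTE cd).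
by case: (i == d).
Qed.

Local Notation gen := (generated_subgroup (minimal_vectors R L)).

Let gen0 : gen 0.
Proof. by have [/asboolP] := generated_subgroup_zmod (minimal_vectors R L). Qed.
Let genB x y : gen x -> gen y -> gen (x - y).
Proof.
have [_ B] := generated_subgroup_zmod (minimal_vectors R L).
by move=> Lx Ly; apply/asboolP/B; apply/asboolP.
Qed.
Let genN x : gen x -> gen (- x). Proof. by rewrite -sub0r; apply: genB. Qed.
Let genD x y : gen x -> gen y -> gen (x + y).
Proof. by move=> Lx Ly; rewrite -[y]opprK; apply: genB => //; apply: genN. Qed.

(* With a + u = c + w in the group, 2a - c - d = (a + u - c - w) + (a + w - u - d);
   four values of u make one of the two summands degenerate. *)
Lemma double_generated a c d : a != c -> a != d -> L (quad a a c d) ->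
  gen (quad a a c d).
Proof.
(* In the group f = 2c - a, and w = c would force u = f. Five indices leave some u outside a, c, d,
   f. *)
move=> ac ad La; have [f Lf] := L_quad c c a.
have [u] : exists u : 'I_n, u \notin [:: a; c; d; f].
  apply: contrapT => /forallNP nou.
  have : (#|[set: 'I_n]%SET| <= size [:: a; c; d; f])%N.
    apply: leq_trans (card_size _); apply: subset_leq_card.
    by apply/fintype.subsetP => u _; have /negP := nou u; rewrite negbK.
  by rewrite cardsT card_ord leqNgt n_ge5.
rewrite !inE !negb_or => /and4P[ua uc ud uf].
have [w Lw] := L_quad a u c.
have Lw2 : L (quad a w u d).
  have -> : quad a w u d = quad a a c d - quad a u c w.
    by row_lia.
  exact: LB.
have wu : w != u.
  apply: contraNneq ac => wu; rewrite wu in Lw; apply/eqP/L_inj.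
  suff -> : e a - e c = quad a u c u by [].
  by row_lia.
have wa : w != a.
  apply: contraNneq uc => wa; rewrite wa in Lw; apply/eqP/L_inj.
  suff -> : e u - e c = quad a u c a by [].
  by row_lia.
have wd : w != d.
  apply: contraNneq ua => wd; rewrite wd in Lw2.
  suff /L_inj-> : L (e a - e u) by [].
  suff -> : e a - e u = quad a d u d by [].
  by row_lia.
have wc : w != c.
  apply: contraNneq uf => wc; rewrite wc in Lw; apply/eqP/L_inj.
  suff -> : e u - e f = quad a u c c + quad c c a f by apply: LD.
  by row_lia.
have -> : quad a a c d = quad a u c w + quad a w u d.
  by row_lia.
by apply: genD; apply/generated_subgroup_mem/quad_minimal => //=;
  rewrite !inE !negb_or ?ac ?ad ?uc ?ud ?wu ?wd /= ?(eq_sym a u) ?(eq_sym a w)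
          ?(eq_sym u w) ?(eq_sym c w) ?ua ?wa ?wu ?wc.
Qed.

(** An index common to both pairs cancels, and [L_inj] makes the remaining difference zero. A
    repetition inside a pair is [double_generated], up to sign. Otherwise the vector is minimal. *)
Lemma quad_generated a b c d : L (quad a b c d) -> gen (quad a b c d).
Proof.
have same x y z : L (quad x y x z) -> gen (quad x y x z).
  have -> : quad x y x z = e y - e z by row_lia.
  by move=> /L_inj ->; rewrite subrr.
have swap1 x y z t : quad x y z t = quad y x z t.
  by row_lia.
have swap2 x y z t : quad x y z t = quad x y t z.
  by row_lia.
have [<-|ac] := eqVneq a c; first exact: same.
have [<-|ad] := eqVneq a d; first by rewrite swap2; apply: same.
have [<-|bc] := eqVneq b c; first by rewrite swap1; apply: same.
have [<-|bd] := eqVneq b d; first by rewrite swap1 swap2; apply: same.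
have [<-|ab] := eqVneq a b; first exact: double_generated.
have [<-|cd] := eqVneq c d.
  have -> : quad a b c c = - quad c c a b by row_lia.
  move=> /LN; rewrite opprK => Lq; apply: genN; apply: double_generated => //.
    by rewrite eq_sym.
  by rewrite eq_sym.
move=> Lq; apply/generated_subgroup_mem/quad_minimal => //=.
by rewrite !inE !negb_or ab ac ad bc bd cd.
Qed.

(** The vector is built up from 0 by adding or subtracting unit vectors. Each such step moves k by
    the group law, and the correction is a quad, hence generated. *)
Lemma reduce_generated (o : 'I_n) (x : 'rV[int]_n) :
  exists k, gen (x - (\sum_i x 0 i) *: e o - (e k - e o)).
Proof.
pose Q (x : 'rV[int]_n) :=
  exists k, gen (x - (\sum_i x 0 i) *: e o - (e k - e o)).
have e_sum (a : 'I_n) : \sum_i (e a : 'rV[int]_n) 0 i = 1.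
  by under eq_bigr do rewrite mxE eqxx; apply: sum_delta.
have QD y i : Q y -> Q (y + e i).
  (* In the group with origin o, l is k + i; the subtraction case below takes k - i. *)
  case=> k yk; have [l Ll] := L_quad k i o; exists l.
  have -> : \sum_j (y + e i) 0 j = \sum_j y 0 j + 1.
    by under eq_bigr do rewrite mxE; rewrite big_split /= e_sum.
  move: (genD yk (quad_generated Ll)); congr gen.
  by row_lia.
have QB y i : Q y -> Q (y - e i).
  case=> k yk; have [l Ll] := L_quad k o i; exists l.
  have -> : \sum_j (y - e i) 0 j = \sum_j y 0 j - 1.
    by under eq_bigr do rewrite !mxE eqxx; rewrite sumrB sum_delta.
  move: (genD yk (quad_generated Ll)); congr gen.
  by row_lia.
have QZ y i (m : int) : Q y -> Q (y + m *: e i).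
  move=> Qy; case: m => m.
    elim: m => [|m IH]; first by rewrite scale0r addr0.
    have -> : y + Posz m.+1 *: e i = y + Posz m *: e i + e i.
      by rewrite intS scalerDl scale1r addrCA addrC.
    exact: QD.
  rewrite NegzE; elim: m.+1 => [|k IH]; first by rewrite oppr0 scale0r addr0.
  have -> : y + (- (Posz k.+1)) *: e i = (y + (- (Posz k)) *: e i) - e i.
    by rewrite intS opprD scalerDl scaleN1r addrA addrAC.
  exact: QB.
rewrite -/(Q x) (row_sum_delta x).
elim/big_rec: _ => [|i y _ Qy]; last by rewrite addrC; apply: QZ.
exists o; rewrite subrr subr0 sub0r big1 ?scale0r ?oppr0 //.
by move=> i _; rewrite mxE.
Qed.

(** A vector of [L] has sum zero, so modulo generated vectors it is some e_k - e_o; this difference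
    lies in [L], and [L_inj] forces k = o. *)
Lemma quad_lattice_generated : L = gen.
Proof.
apply/predeqP=> x; split; last first.
  by apply: generated_subgroup_sub => // y [].
move=> Lx; pose o : 'I_n := Ordinal (leq_trans (isT : 0 < 5)%N n_ge5).
have [k] := reduce_generated o x; rewrite (L_sum0 Lx) scale0r subr0 => gk.
have Lk : L (x - (e k - e o)).
  by apply: generated_subgroup_sub gk => // y [].
have : L (e k - e o) by rewrite -[e k - e o](subKr x); apply: LB.
by move/L_inj => ko; move: gk; rewrite ko subrr subr0.
Qed.

End QuadLattice.

(** * Dependence over [K[x]] *)

Section Dependence.
Variables (K F : fieldType) (iota : {rmorphism K -> F}).

Definition poly_eval (x : F) (p : {poly K}) : F := (map_poly iota p).[x].

HB.instance Definition _ (x : F) := GRing.RMorphism.copy (poly_eval x)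
  (horner_eval x \o map_poly iota).

Local Notation ev := poly_eval.

Let ev_scale x c p : ev x (c *: p) = iota c * ev x p.
Proof. by rewrite /ev map_polyZ /= hornerZ. Qed.

Let ev_Xn x i : ev x 'X^i = x ^+ i.
Proof. by rewrite /ev map_polyXn hornerXn. Qed.

Lemma clear_denominators (x : F) (T : finType) (c : T -> F) :
  (forall t, rational_subfield iota x (c t)) ->
  exists2 d, ev x d != 0 &
    exists p : T -> {poly K}, forall t, ev x d * c t = ev x (p t).
Proof.
move=> cP.
have /fin_all_exists[pq pqP] : forall t, exists pq : {poly K} * {poly K},
    ev x pq.2 != 0 /\ c t = ev x pq.1 / ev x pq.2.
  by move=> t; have [p [q pqP]] := cP t; exists (p, q).
exists (\prod_t (pq t).2).
  by rewrite rmorph_prod; apply/prodf_neq0 => t _; have [] := pqP t.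
exists (fun t => (pq t).1 * \prod_(s | s != t) (pq s).2) => t.
have [q0 ->] := pqP t.
by rewrite (bigD1 t) //= !rmorphM mulrAC [_ * (_ / _)]mulrCA divff // mulr1.
Qed.

(* Coordinates of [x ^+ i * y k] over [K[x0]] have degree [e * i + O(1)], so
   once there are more than [m * e] elements [y k] the monomials [x ^+ i * y k],
   [i <= I], outnumber the available coordinates when [I] is large. *)
Lemma polynomial_relation (x : F) : function_field iota ->
  exists N, forall y : 'I_N.+1 -> F,
    exists2 p : 'I_N.+1 -> {poly K}, exists i, p i != 0
      & \sum_i (map_poly iota (p i)).[x] * y i = 0.
Proof.
case=> x0 [_ [m [b bP]]].
have coord (T : finType) (y : T -> F) : exists2 d, ev x0 d != 0 &
    exists A : T -> 'I_m -> {poly K},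
      forall t, ev x0 d * y t = \sum_j ev x0 (A t j) * b j.
  have /fin_all_exists[c cP] := fun t => bP (y t).
  have [|d d0 [p pP]] := @clear_denominators x0 _ (fun tj : T * 'I_m => c tj.1 tj.2).
    by case=> t j; have [] := cP t.
  exists d => //; exists (fun t j => p (t, j)) => t.
  have [_ ->] := cP t; rewrite mulr_sumr; apply: eq_bigr => j _.
  by rewrite -pP mulrA.
(* Multiplication by d x acts on the spanning family [b] through the polynomial matrix [A]. *)
have [d d0 [A AP]] := coord _ (fun l => x * b l).
pose e := maxn (size d) (\max_(lj : 'I_m * 'I_m) size (A lj.1 lj.2)).
have sd : (size d <= e)%N by apply: leq_maxl.
have sA l j : (size (A l j) <= e)%N.
  apply: leq_trans (leq_maxr _ _).
  exact: (leq_bigmax (F := fun lj : 'I_m * 'I_m => size (A lj.1 lj.2)) (l, j)).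
exists (m * e)%N => y; set N := (m * e)%N in y *.
have [d' d'0 [Y YP]] := coord _ y.
pose c := \max_(kj : 'I_N.+1 * 'I_m) size (Y kj.1 kj.2).
have sY k j : (size (Y k j) <= c)%N.
  exact: (leq_bigmax (F := fun lj : 'I_N.+1 * 'I_m => size (Y lj.1 lj.2)) (k, j)).
(* [V i k] is the coordinate row of (d x)^i d' y_k: the row [Y k] multiplied i times by [A], so its
   sizes grow by at most e each time. *)
pose V := fix V i (k : 'I_N.+1) (j : 'I_m) :=
  if i is i'.+1 then \sum_l V i' k l * A l j else Y k j.
have VP i k : \sum_j ev x0 (V i k j) * b j = (ev x0 d * x) ^+ i * (ev x0 d' * y k).
  elim: i => [|i IH] /=; first by rewrite mul1r YP.
  rewrite exprS -mulrA -IH mulr_sumr.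
  under eq_bigr do rewrite rmorph_sum mulr_suml.
  rewrite exchange_big; apply: eq_bigr => l _ /=.
  rewrite [RHS]mulrCA -[in RHS]mulrA AP mulr_sumr; apply: eq_bigr => j _.
  by rewrite rmorphM mulrA.
have sV i k j : (size (V i k j) <= c + e * i)%N.
  elim: i k j => [|i IH] k j /=; first by rewrite muln0 addn0.
  apply: leq_trans (size_sum _ _ _) _; apply/bigmax_leqP => l _.
  apply: leq_trans (size_polyMleq _ _) _.
  by have := IH k l; have := sA l j; rewrite mulnS; lia.
(* With this I the (m e + 1)(m c + 1) unknowns outnumber the m (c + e m c) equations. The factor
   d^(I - i) in [W] brings all monomials x^i y_k to the common denominator d^I d'. *)
pose I := (m * c)%N.
pose W i k j := d ^+ (I - i) * V i k j.
have sW i k j : (i <= I)%N -> (size (W i k j) <= c + e * I)%N.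
  move=> iI; apply: leq_trans (size_polyMleq _ _) _.
  have := sV i k j; have := size_poly_exp_leq d (I - i).
  have := leq_mul (leq_trans (leq_pred _) sd) (leqnn (I - i)).
  by rewrite mulnBr; have := leq_mul (leqnn e) iI; lia.
have [|cc [[k0 i0] cc0] ccP] := @exists_relation K ('I_N.+1 * 'I_I.+1)%type
    ('I_m * 'I_(c + e * I))%type (fun ki js => (W ki.2 ki.1 js.1)`_js.2).
  by rewrite !card_prod !card_ord /N /I; nia.
exists (fun k => \sum_(i < I.+1) cc (k, i) *: 'X^i).
  exists k0; apply: contraNneq cc0 => /(congr1 (fun q : {poly K} => q`_i0)).
  rewrite coef0 coef_sum (bigD1 i0) //= coefZ coefXn eqxx mulr1 big1 ?addr0 => [->//|].
  by move=> i /negbTE; rewrite coefZ coefXn eq_sym -val_eqE /= => ->; rewrite mulr0.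
apply/eqP; rewrite -(mulrI_eq0 _ (mulfI (mulf_neq0 (expf_neq0 I d0) d'0))); apply/eqP.
rewrite -[RHS](_ : \sum_j ev x0 (\sum_ki cc ki *: W ki.2 ki.1 j) * b j = 0).
  under [RHS]eq_bigr do rewrite rmorph_sum mulr_suml.
  rewrite exchange_big /=.
  have pE k : (map_poly iota (\sum_(i < I.+1) cc (k, i) *: 'X^i)).[x] =
      \sum_(i < I.+1) iota (cc (k, i)) * x ^+ i.
    rewrite -/(ev x _) rmorph_sum.
    by apply: eq_bigr => i _; rewrite /= ev_scale ev_Xn.
  transitivity (\sum_k \sum_(i < I.+1)
      ev x0 d ^+ I * ev x0 d' * (iota (cc (k, i)) * x ^+ i * y k)).
    by rewrite mulr_sumr; apply: eq_bigr => k _; rewrite pE mulr_suml mulr_sumr.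
  rewrite pair_bigA; apply: eq_bigr => -[k i] _ /=.
  under eq_bigr do rewrite ev_scale /W rmorphM rmorphXn -!mulrA.
  rewrite -!mulr_sumr VP exprMn.
  have iI : (i <= I)%N by rewrite -ltnS.
  rewrite (_ : ev x0 d ^+ I = ev x0 d ^+ (I - i) * ev x0 d ^+ i); last first.
    by rewrite -exprD subnK.
  rewrite /= -!mulrA; set D := ev x0 d.
  rewrite [ev x0 d' * (iota _ * _)]mulrCA [D ^+ i * (iota _ * _)]mulrCA.
  by rewrite [_ * (iota _ * _)]mulrCA [ev x0 d' * (x ^+ _ * _)]mulrCA.
apply: big1 => j _.
rewrite [X in ev x0 X](_ : _ = 0) ?rmorph0 ?mul0r //.
apply/polyP => s; rewrite coef0 coef_sum.
have [ss|ss] := ltnP s (c + e * I).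
  rewrite -[RHS](ccP (j, Ordinal ss)).
  by apply: eq_bigr => ki _; rewrite coefZ.
apply: big1 => ki _; rewrite coefZ nth_default ?mulr0 //.
by apply: leq_trans (sW _ _ _ _) ss; rewrite -ltnS.
Qed.

End Dependence.

(** * Places *)

Section PlaceRing.
Variables (K F : fieldType) (iota : {rmorphism K -> F}) (Q : place iota).
Implicit Types (x y z : F).

Local Notation O := (place_ring Q).
Local Notation ideal := (place_ideal Q).

Lemma place1 : 1 \in O.
Proof. by have [[]] := place_ringP Q. Qed.

Lemma placeB x y : x \in O -> y \in O -> x - y \in O.
Proof. by have [[_ B _] _ _ _ _] := place_ringP Q; apply: B. Qed.

Lemma placeM x y : x \in O -> y \in O -> x * y \in O.
Proof. by have [[_ _ M] _ _ _ _] := place_ringP Q; apply: M. Qed.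

Lemma place_const c : iota c \in O.
Proof. by have [] := place_ringP Q. Qed.

Lemma place0 : 0 \in O.
Proof. by rewrite -(rmorph0 iota) place_const. Qed.

Lemma placeN x : x \in O -> - x \in O.
Proof. by rewrite -sub0r; apply: placeB; apply: place0. Qed.

Lemma placeD x y : x \in O -> y \in O -> x + y \in O.
Proof. by move=> xO yO; rewrite -[y]opprK placeB ?placeN. Qed.

Lemma placeX x n : x \in O -> x ^+ n \in O.
Proof.
by move=> xO; elim: n => [|n IH]; rewrite ?place1 // exprS placeM.
Qed.

Lemma place_sum (I : Type) (r : seq I) (p : pred I) (f : I -> F) :
  (forall i, p i -> f i \in O) -> \sum_(i <- r | p i) f i \in O.
Proof. by move=> fO; elim/big_ind: _ => //; [exact: place0 | exact: placeD]. Qed.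

Lemma place_horner x (p : {poly K}) : x \in O -> (map_poly iota p).[x] \in O.
Proof.
move=> xO; rewrite horner_coef; apply: place_sum => i _.
by rewrite coef_map placeM ?place_const ?placeX.
Qed.

Lemma place_total z : z \in O \/ z^-1 \in O.
Proof.
have [->|z0] := eqVneq z 0; first by left; apply: place0.
by have [_ _ _ _] := place_ringP Q; apply.
Qed.

Lemma ideal_place z : ideal z -> z \in O.
Proof. by case/andP. Qed.

Lemma ideal0 : ideal 0.
Proof. by rewrite /place_ideal place0 /place_unit eqxx. Qed.

Lemma idealE z : z != 0 -> ideal z = (z^-1 \notin O).
Proof.
move=> z0; rewrite /place_ideal /place_unit z0 /=.
by have [->//|zO] := place_total z; rewrite zO andbT andbN.
Qed.

Lemma ideal1 : ideal 1 = false.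
Proof. by rewrite idealE ?oner_neq0 // invr1 place1. Qed.

Lemma idealM x y : ideal x -> y \in O -> ideal (x * y).
Proof.
have [->|x0] := eqVneq x 0; first by rewrite mul0r.
have [->|y0] := eqVneq y 0; first by rewrite mulr0 ideal0.
rewrite !idealE ?mulf_neq0 // => xO yO; apply: contra xO => xyO.
by rewrite -[x^-1](mulfVK y0) -invfM placeM.
Qed.

Lemma idealN x : ideal x -> ideal (- x).
Proof. by move=> xI; rewrite -mulrN1 idealM // placeN ?place1. Qed.

(** By symmetry x / y may be taken in [O], and then x + y = y (x / y + 1). *)
Lemma idealD x y : ideal x -> ideal y -> ideal (x + y).
Proof.
have [->|x0] := eqVneq x 0; first by rewrite add0r.
have [->|y0] := eqVneq y 0; first by rewrite addr0.
wlog xy : x y x0 y0 / x / y \in O.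
  move=> W; have [/W|] := place_total (x / y); first exact.
  by rewrite invf_div addrC => /W W' /W' H /H; apply.
move=> _ yI; have -> : x + y = y * (x / y + 1).
  by rewrite mulrDr mulr1 mulrCA divff // mulr1.
by rewrite idealM // placeD // place1.
Qed.

Lemma ideal_sum (I : Type) (r : seq I) (p : pred I) (f : I -> F) :
  (forall i, p i -> ideal (f i)) -> ideal (\sum_(i <- r | p i) f i).
Proof. by move=> fO; elim/big_ind: _ => //; [exact: ideal0 | exact: idealD]. Qed.

Lemma place_unitP z : place_unit Q z = (z \in O) && ~~ ideal z.
Proof.
rewrite /place_ideal /place_unit.
by case: (z \in O); rewrite ?andbF //= negbK.
Qed.

Lemma place_unit_neq0 z : place_unit Q z -> z != 0.
Proof. by case/and3P. Qed.

Lemma place_unitV z : place_unit Q z -> place_unit Q z^-1.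
Proof. by case/and3P=> *; apply/and3P; rewrite invr_eq0 invrK. Qed.

Lemma place_unitM x y : place_unit Q x -> place_unit Q y -> place_unit Q (x * y).
Proof.
case/and3P=> x0 xO xV /and3P[y0 yO yV]; apply/and3P.
by rewrite mulf_neq0 // invfM !placeM.
Qed.

Lemma place_unitXz x (m : int) : place_unit Q x -> place_unit Q (x ^ m).
Proof.
have u1 : place_unit Q 1 by rewrite place_unitP place1 ideal1.
have H (n : nat) z : place_unit Q z -> place_unit Q (z ^+ n).
  by move=> zu; elim: n => [|n IH]; rewrite // exprS place_unitM.
by case: m => m xu; [apply: H | rewrite NegzE -invr_expz place_unitV //; apply: H].
Qed.

Lemma place_unit_const c : c != 0 -> place_unit Q (iota c).
Proof.
move=> c0; rewrite /place_unit fmorph_eq0 c0 place_const -fmorphV.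
by rewrite place_const.
Qed.

Lemma place_unit_constD c x : c != 0 -> ideal x -> place_unit Q (iota c + x).
Proof.
move=> c0 xI; rewrite place_unitP placeD ?place_const ?ideal_place //=.
apply/negP => /idealD /(_ (idealN xI)); rewrite addrK.
by apply/negP; have := place_unit_const c0; rewrite place_unitP => /andP[].
Qed.

Lemma ideal_nontrivial : exists2 x, x != 0 & ideal x.
Proof.
have [_ _ _ [z zO] _] := place_ringP Q.
have z0 : z != 0 by apply: contraNneq zO => ->; apply: place0.
by exists z^-1; rewrite ?idealE ?invr_eq0 // invrK.
Qed.

(** The hypothesis is a valuation-free way to say that the valuations of the s_i strictly decrease;
    consecutive comparisons compose. *)
Lemma chain_ideal N (s : nat -> F) :
  (forall i, (i < N)%N -> ideal (s i / s i.+1)) ->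
  (forall i, (i < N)%N -> s i.+1 != 0) ->
  forall i j, (i < j <= N)%N -> ideal (s i / s j).
Proof.
move=> sI s0 i; elim=> // j IH /andP[ij jN].
have [ilj|] := ltnP i j; last first.
  by move=> ji; rewrite (_ : i = j) ?sI //; lia.
have sj : s j != 0 by case: j ilj jN {IH ij} => // j _ jN; apply: s0; lia.
rewrite -[s i](divfK sj) -[X in ideal X]mulrA; apply: idealM; last exact/ideal_place/sI.
by apply: IH; rewrite ilj ltnW.
Qed.

(** The last term with a nonzero coefficient has the strictly smallest valuation and dominates the
    sum. In particular the sum is nonzero, so the s_i are independent over [K]. *)
Lemma leading_term N (s : nat -> F) (c : 'I_N.+1 -> K) :
  (forall i, (i < N)%N -> ideal (s i / s i.+1)) ->
  (forall i, (i <= N)%N -> s i != 0) -> (exists i, c i != 0) ->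
  exists i : 'I_N.+1, exists2 u, place_unit Q u &
    \sum_i iota (c i) * s i = s i * u.
Proof.
move=> sI s0 [i0 ci0].
have [i ci imax] := @arg_maxnP _ i0 (fun i => c i != 0) val ci0.
exists i; exists (iota (c i) + \sum_(j | j != i) iota (c j) * (s j / s i)).
  apply: place_unit_constD => //; apply: ideal_sum => j ji.
  have [->|cj] := eqVneq (c j) 0; first by rewrite rmorph0 mul0r ideal0.
  rewrite mulrC idealM ?place_const // (chain_ideal sI) //.
    by move=> k kN; apply: s0.
  rewrite ltn_neqAle -val_eqE /= in ji *; rewrite ji; have := imax j cj.
  by have := ltn_ord i; rewrite ltnS => -> /= ->.
rewrite (bigD1 i) //= mulrDr mulrC mulr_sumr; congr (_ + _).
apply: eq_bigr => j _; rewrite mulrCA; congr (_ * _).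
by rewrite mulrCA divff ?mulr1 // s0 // -ltnS.
Qed.

End PlaceRing.

(** * Discreteness of places and their valuations *)

Section DiscreteValuation.
Variables (K F : fieldType) (iota : {rmorphism K -> F}).
Hypothesis F_function_field : function_field iota.
Variable Q : place iota.
Implicit Types (x y z t : F).

Local Notation O := (place_ring Q).
Local Notation ideal := (place_ideal Q).
Local Notation v := (valuation Q).

(* After division by a power of [x], the constant terms of a relation over
   [K[x]] give a nontrivial relation over [K] modulo [x]. *)
Lemma dependent_mod x : x != 0 -> ideal x ->
  exists N, forall y : 'I_N.+1 -> F, (forall i, y i \in O) ->
    exists2 c : 'I_N.+1 -> K, exists i, c i != 0
      & (\sum_i iota (c i) * y i) / x \in O.
Proof.
move=> x0 xI; have [N NP] := polynomial_relation x F_function_field.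
exists N => y yO; have [p [i0 pi0] pP] := NP y.
have exk : exists k, [exists i, (p i)`_k != 0].
  exists (size (p i0)).-1; apply/existsP; exists i0.
  by rewrite -lead_coefE lead_coef_eq0.
case: (ex_minnP exk) => k /existsP ck kmin.
exists (fun i => (p i)`_k) => //.
have pE i : p i = (p i)`_k *: 'X^k + drop_poly k.+1 (p i) * 'X^(k.+1).
  apply/polyP => j; rewrite coefD coefZ coefXn coefMXn coef_drop_poly ltnS.
  case: (ltngtP j k) => [jk|kj|->]; last by rewrite mulr1 addr0.
    rewrite mulr0 addr0; apply/eqP; apply: contraTT jk => pj.
    by rewrite -leqNgt; apply: kmin; apply/existsP; exists i.
  by rewrite mulr0 add0r subnK.
have pS : \sum_i (map_poly iota (p i)).[x] * y i =
    x ^+ k * (\sum_i iota (p i)`_k * y i +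
      x * \sum_i (map_poly iota (drop_poly k.+1 (p i))).[x] * y i).
  rewrite !mulr_sumr -big_split mulr_sumr; apply: eq_bigr => i _ /=.
  rewrite [in LHS]pE rmorphD rmorphM /= map_polyZ !map_polyXn /= hornerD hornerM.
  rewrite hornerZ !hornerXn exprS mulrDl mulrDr; congr (_ + _).
    by rewrite mulrAC mulrC.
  by rewrite mulrAC [LHS]mulrC -[LHS]mulrA [LHS]mulrCA.
move: pP; rewrite pS => /eqP; rewrite mulf_eq0 expf_eq0 (negbTE x0) andbF /=.
rewrite addr_eq0 => /eqP ->; rewrite mulNr mulrAC divff // mul1r placeN //.
by apply: place_sum => i _; rewrite placeM // place_horner // ideal_place.
Qed.

(** In a longer chain, [dependent_mod] gives a nontrivial combination of the later terms divisible
    by x. By [leading_term] it is a unit times some s_i, yet x / s_i lies in the maximal ideal. *)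
Lemma chain_bounded x : x != 0 -> ideal x -> exists N, forall s : nat -> F,
  s 0%N = x ->
  (forall i, (i <= N)%N ->
     [/\ s i.+1 != 0, s i.+1 \in O & ideal (s i / s i.+1)]) -> False.
Proof.
move=> x0 xI; have [N NP] := dependent_mod x0 xI; exists N => s s0 sP.
have [|c c0 cO] := NP (fun i : 'I_N.+1 => s i.+1).
  by move=> i; have [] := sP i (ltn_ord i).
have [|||i [u uU E]] := @leading_term _ _ _ Q N (s \o succn) c.
- by move=> i iN /=; have [] := sP i.+1 iN.
- by move=> i iN /=; have [] := sP i iN.
- by [].
rewrite E /= in cO.
have : ideal (s 0%N / s i.+1).
  apply: (@chain_ideal _ _ _ Q N.+1) => //=.
  - by move=> j jN; have [] := sP j jN.
  - by move=> j jN; have [] := sP j jN.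
have si : s i.+1 != 0 by have [] := sP i (ltn_ord i).
rewrite s0 idealE ?mulf_neq0 ?invr_eq0 // invf_div => /negP; apply.
rewrite -[s i.+1](mulfK (place_unit_neq0 uU)) mulrAC placeM //.
by case/and3P: uU.
Qed.

(** If no s in the ideal generates it, some z in the ideal is not a multiple of s, and then s / z is
    in the ideal. Iterating s -> z contradicts [chain_bounded]. *)
Lemma prime_element_exists : exists t, prime_element Q t.
Proof.
apply: contrapT => /forallNP noprime.
have [x x0 xI] := ideal_nontrivial Q.
have step s : exists s', s != 0 -> ideal s ->
    [/\ s' != 0, ideal s' & ideal (s / s')].
  have [s0|] := pselect (s != 0 /\ ideal s); last first.
    by move=> ns; exists 0 => s0 sI; case: ns.
  case: s0 => s0 sI; have /existsNP[z nz] := noprime s.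
  have [zI nzs] : ideal z /\ z / s \notin O.
    have [zI|zI] := boolP (ideal z); last first.
      by case: nz; split=> [|[y yO zE]]; [rewrite (negbTE zI) | rewrite zE idealM].
    split=> //; apply: contra_notN nz => zs; split=> // _; exists (z / s) => //.
    by rewrite mulrC divfK.
  have z0 : z != 0 by apply: contraNneq nzs => ->; rewrite mul0r place0.
  by exists z => _ _; split; rewrite // idealE ?mulf_neq0 ?invr_eq0 // invf_div.
have [f fP] := choice step.
have iP i : iter i f x != 0 /\ ideal (iter i f x).
  by elim: i => [|i [s0 sI]] //=; have [] := fP _ s0 sI.
have [N NP] := chain_bounded x0 xI.
apply: (NP (fun i => iter i f x)) => // i _ /=.
have [s0 sI] := iP i; have [s0' sI' ssI] := fP _ s0 sI.
by split=> //; apply: ideal_place.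
Qed.

Lemma prime_ideal t : prime_element Q t -> ideal t.
Proof. by move=> tP; apply/tP; exists 1; rewrite ?place1 ?mulr1. Qed.

Lemma prime_neq0 t : prime_element Q t -> t != 0.
Proof.
move=> tP; have [x x0 /tP[y _ xE]] := ideal_nontrivial Q.
by apply: contraNneq x0 => t0; rewrite xE t0 mul0r.
Qed.

(** For z in [O], m is the largest exponent with z / t^m in [O]; the quotient is a unit, since
    otherwise t would divide it once more. Other z are handled through their inverse. *)
Lemma prime_decomposition t z : prime_element Q t -> z != 0 ->
  exists (m : int) u, place_unit Q u /\ z = t ^ m * u.
Proof.
move=> tP; have t0 := prime_neq0 tP; have tI := prime_ideal tP.
have H (y : F) : y != 0 -> y \in O ->
    exists (m : nat) u, place_unit Q u /\ y = t ^+ m * u.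
  move=> y0 yO; have [yI|yI] := boolP (ideal y); last first.
    by exists 0%N, y; rewrite mul1r place_unitP yO.
  have [N NP] := chain_bounded y0 yI.
  have exm : exists m, y / t ^+ m \notin O.
    apply: contrapT => /forallNP noM.
    have yt m : y / t ^+ m \in O by have /negP := noM m; rewrite negbK.
    (* The chain is y, t^(N+1), t^N, ..., t. Its first ratio lies in the ideal because y / t^(N+2)
       is in [O]. *)
    apply: (NP (fun i => if i is i'.+1 then t ^+ (N.+1 - i') else y)) => // i iN.
    have tO := ideal_place tI.
    split; rewrite ?expf_neq0 // ?placeX //.
    case: i iN => [|i] iN.
      rewrite subn0 -[y](divfK (expf_neq0 N.+2 t0)) -[X in ideal X]mulrA.
      have -> : t ^+ N.+2 / t ^+ N.+1 = t by rewrite exprS mulfK ?expf_neq0.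
      by rewrite mulrC idealM.
    have -> : (N.+1 - i = (N.+1 - i.+1).+1)%N by lia.
    by rewrite exprS mulfK // expf_neq0.
  case: (ex_minnP exm) => -[|m] ym mmin; first by rewrite expr0 divr1 yO in ym.
  exists m, (y / t ^+ m); split; last by rewrite mulrC divfK // expf_neq0.
  rewrite place_unitP; apply/andP; split.
    by apply: contraT => /mmin; rewrite ltnn.
  apply: contra ym => /tP[w wO E]; suff -> : y / t ^+ m.+1 = w by [].
  by rewrite exprSr invfM mulrA E mulrC mulKf.
move=> z0; have [zO|zO] := place_total Q z.
  by have [m [u [uU ->]]] := H z z0 zO; exists m%:Z, u.
have [||m [u [uU E]]] := H z^-1; rewrite ?invr_eq0 //.
exists (- m%:Z), u^-1; split; first exact: place_unitV.
by rewrite -[z]invrK E invfM exprnN.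
Qed.

Lemma prime_exp_unit t (m : int) : prime_element Q t -> place_unit Q (t ^ m) -> m = 0.
Proof.
move=> tP; have tI := prime_ideal tP.
have H k : place_unit Q (t ^+ k.+1) -> False.
  rewrite place_unitP => /andP[_ /negP]; apply.
  by rewrite exprS idealM // placeX // ideal_place.
case: m => [[|k]|k] //; first by move/H.
by rewrite NegzE -invr_expz => /place_unitV; rewrite invrK => /H.
Qed.

(** Two prime elements differ by a unit, so the exponent does not depend on the one chosen by
    [xget]. *)
Lemma valuationE t (m : int) u : prime_element Q t -> place_unit Q u ->
  v (t ^ m * u) = m.
Proof.
move=> tP uU; apply: xget_unique; first by exists t, u.
move=> m' [t' [u' [tP' uU' E]]].
have t0 := prime_neq0 tP; have t0' := prime_neq0 tP'.
have /tP[w wO wE] := prime_ideal tP'.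
have wU : place_unit Q w.
  have /tP'[w' wO' wE'] := prime_ideal tP.
  have w0 : w != 0 by apply: contraNneq t0' => w0; rewrite wE w0 mulr0.
  apply/and3P; split=> //; suff -> : w^-1 = w' by [].
  apply: (mulfI w0); rewrite divff //; apply: (mulfI t0).
  by rewrite mulr1 mulrA -wE -wE'.
apply/eqP; rewrite -subr_eq0; apply/eqP/(prime_exp_unit tP).
rewrite expfzDr // -invr_expz.
have -> : t ^ m' / t ^ m = u / (w ^ m' * u').
  have n1 : w ^ m' * u' != 0.
    by rewrite (@place_unit_neq0 _ _ _ Q) // place_unitM // place_unitXz.
  apply/eqP; rewrite eqr_div ?expfz_neq0 //; apply/eqP.
  by rewrite mulrA -expfzMl -wE -E mulrC.
by rewrite place_unitM // place_unitV // place_unitM // place_unitXz.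
Qed.

Lemma valuationM x y : x != 0 -> y != 0 -> v (x * y) = v x + v y.
Proof.
have [t tP] := prime_element_exists; have t0 := prime_neq0 tP.
move=> /(prime_decomposition tP)[m [u [uU ->]]].
move=> /(prime_decomposition tP)[k [w [wU ->]]].
by rewrite mulrACA -expfzDr // !valuationE // place_unitM.
Qed.

Lemma valuation_unit u : place_unit Q u -> v u = 0.
Proof.
have [t tP] := prime_element_exists.
by move=> uU; rewrite -[u]mul1r -(expr0z t) valuationE.
Qed.

Lemma valuation1 : v 1 = 0.
Proof. by rewrite valuation_unit // place_unitP place1 ideal1. Qed.

Lemma valuationV x : x != 0 -> v x^-1 = - v x.
Proof.
move=> x0; have xV0 : x^-1 != 0 by rewrite invr_eq0.
have := valuationM xV0 x0; rewrite mulVf // valuation1 => /eqP.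
by rewrite eq_sym addr_eq0 => /eqP.
Qed.

Lemma valuationX x k : x != 0 -> v (x ^+ k) = v x *+ k.
Proof.
move=> x0; elim: k => [|k IH]; first exact: valuation1.
by rewrite exprS mulrS valuationM ?expf_neq0 // IH.
Qed.

Lemma valuation_gt0 x : x != 0 -> (0 < v x) = ideal x.
Proof.
have [t tP] := prime_element_exists; have tI := prime_ideal tP.
have H z : z != 0 -> 0 < v z -> ideal z.
  move=> /(prime_decomposition tP)[m [u [uU ->]]]; rewrite valuationE //.
  case: m => [[|m]|m] m0; rewrite ?ltxx // in m0; rewrite -exprnP exprS -mulrA idealM //.
  have tO := ideal_place tI.
  by rewrite placeM ?placeX //; case/and3P: uU.
move=> x0; apply/idP/idP => [|xI]; first exact: H.
rewrite ltNge; apply/negP; rewrite le_eqVlt => /orP[/eqP vx|vx].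
  have [m [u [uU xE]]] := prime_decomposition tP x0.
  move: vx xI; rewrite xE valuationE // => ->; rewrite mul1r.
  by move: uU; rewrite place_unitP => /andP[_ /negP].
have /H : 0 < v x^-1 by rewrite valuationV // oppr_gt0.
rewrite invr_eq0 => /(_ x0)/ideal_place.
by move: xI; rewrite idealE // => /negP.
Qed.

Lemma valuation_ge0 x : x != 0 -> (0 <= v x) = (x \in O).
Proof.
move=> x0; rewrite leNgt -oppr_gt0 -valuationV // valuation_gt0 ?invr_eq0 //.
by rewrite idealE ?invr_eq0 // invrK negbK.
Qed.

Lemma uniformizer_exists : exists2 t, t != 0 & v t = 1.
Proof.
have [t tP] := prime_element_exists; exists t; first exact: prime_neq0.
rewrite -[t]mulr1 -[t in t * 1]expr1z valuationE //.
by rewrite place_unitP place1 ideal1.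
Qed.

End DiscreteValuation.

(** * Dimensions of quotients *)

Section Dimension.
Variables (K F : fieldType) (iota : {rmorphism K -> F}).
Implicit Types (U W : set F).

Definition subspace W : Prop :=
  [/\ W 0, forall x y, W x -> W y -> W (x + y) & forall c x, W x -> W (iota c * x)].

(** An upper bound on dim U / W expressed by dependence: it is meaningful before a basis is known,
    whereas [dim_mod] may be the default 0. *)
Definition dim_le U W N : Prop := forall n (y : 'I_n -> F), (N < n)%N ->
  (forall i, U (y i)) ->
  exists2 c : 'I_n -> K, exists i, c i != 0 & W (\sum_i iota (c i) * y i).

Lemma subspace_comb W (T : finType) (c : T -> K) (y : T -> F) : subspace W ->
  (forall i, W (y i)) -> W (\sum_i iota (c i) * y i).
Proof.
by case=> W0 WD WZ Wy; elim/big_ind: _ => // i _; apply: WZ.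
Qed.

Lemma subspace_zero : subspace [set 0].
Proof. by split=> [|x y -> ->|c x ->] //=; rewrite ?addr0 ?mulr0. Qed.

(** A relation between the coordinate rows of the y_i cancels the spanning elements and leaves only
    the errors, which lie in [W]. *)
Lemma spanning_dim_le U W n (b : 'I_n -> F) : subspace W ->
  (forall z, U z -> exists c : 'I_n -> K, W (z - \sum_i iota (c i) * b i)) ->
  dim_le U W n.
Proof.
move=> Ws Ub k y nk Uy.
have /fin_all_exists[A AP] := fun i => Ub _ (Uy i).
have [|c c0 cA] := @exists_relation K 'I_k 'I_n A; first by rewrite !card_ord.
exists c => //.
suff -> : \sum_i iota (c i) * y i =
    \sum_i iota (c i) * (y i - \sum_j iota (A i j) * b j).
  exact: subspace_comb.
under [RHS]eq_bigr do rewrite mulrBr.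
rewrite sumrB [X in _ = _ - X](_ : _ = 0) ?subr0 //.
under eq_bigr do rewrite mulr_sumr.
rewrite exchange_big big1 // => j _.
under eq_bigr do rewrite mulrA -rmorphM.
by rewrite -mulr_suml -rmorph_sum cA rmorph0 mul0r.
Qed.

(** An independent family of maximal size is a basis: adjoining z creates a relation modulo [W], in
    which the coefficient of z is nonzero and can be divided out. *)
Lemma basis_exists U W N : subspace U -> subspace W ->
  (forall y : 'I_N.+1 -> F, (forall i, U (y i)) ->
     exists2 c : 'I_N.+1 -> K, exists i, c i != 0 & W (\sum_i iota (c i) * y i)) ->
  exists n (b : 'I_n -> F), basis_mod iota U W b.
Proof.
move=> Us Ws dep.
pose indep n := exists2 b : 'I_n -> F, forall i, U (b i) &
  forall c : 'I_n -> K, W (\sum_i iota (c i) * b i) -> forall i, c i = 0.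
have exn : exists n, ~~ `[< indep n.+1 >].
  exists N; apply/negP => /asboolP[b Ub bi].
  by have [c [i ci] /bi cW] := dep b Ub; rewrite cW eqxx in ci.
case: (ex_minnP exn) => n /negP nind nmin.
have [b Ub bi] : indep n.
  case: n nind nmin => [|n] _ nmin.
    by exists (fun=> 0) => [[]//|c _ []].
  apply: contrapT => nn; suff : (n.+1 <= n)%N by rewrite ltnn.
  by apply: nmin; apply/negP => /asboolP.
exists n, b; split=> // z Uz; apply: contrapT => noc; apply: nind; apply/asboolP.
exists (fun i => if unlift ord0 i is Some j then b j else z).
  by move=> i; case: unliftP.
have [W0 WD WZ] := Ws.
move=> c; rewrite big_ord_recl unlift_none.
under eq_bigr do rewrite liftK.
have [c0|c0] := eqVneq (c ord0) 0.
  rewrite c0 rmorph0 mul0r add0r => /bi cz i.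
  by case: (unliftP ord0 i) => [j|] ->.
move=> Wc; exfalso; apply: noc.
exists (fun i => - ((c ord0)^-1 * c (fintype.lift ord0 i))).
have := WZ (c ord0)^-1 _ Wc; rewrite mulrDr mulrA -rmorphM mulVf // rmorph1 mul1r.
rewrite mulr_sumr; congr W; congr (_ + _); rewrite -sumrN.
by apply: eq_bigr => i _; rewrite rmorphN rmorphM mulNr opprK mulrA.
Qed.

Lemma dim_mod_basis U W n (b : 'I_n -> F) : basis_mod iota U W b ->
  exists b' : 'I_(dim_mod iota U W) -> F, basis_mod iota U W b'.
Proof.
move=> bP; pose S := [set n | exists b : 'I_n -> F, basis_mod iota U W b].
by apply: (@xgetI _ 0%N S n); exists b.
Qed.

(** A positive value cannot be the default of [xget]. *)
Lemma dim_mod_gt0 U W : (0 < dim_mod iota U W)%N ->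
  exists b : 'I_(dim_mod iota U W) -> F, basis_mod iota U W b.
Proof. by rewrite /dim_mod; case: xgetP. Qed.

End Dimension.

(** * Divisors *)

Section Divisors.
Variables (K F : fieldType) (iota : {rmorphism K -> F}).
Hypothesis F_function_field : function_field iota.
Implicit Types (Q : place iota) (D C B : divisor iota) (f h : F).

Local Notation deg := (@divisor_degree _ _ iota).
Local Notation RR := (@riemann_roch_space _ _ iota).

Lemma place_subspace Q : subspace iota [set z | z \in place_ring Q].
Proof.
split=> /= [|x y|c x xO]; [exact: place0 | exact: placeD |].
by rewrite placeM ?place_const.
Qed.

Lemma ideal_subspace Q : subspace iota [set z | place_ideal Q z].
Proof.
split=> /= [|x y|c x xI]; [exact: ideal0 | exact: idealD |].
by rewrite mulrC idealM ?place_const.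
Qed.

(** Dependence modulo x [O] implies dependence modulo the maximal ideal, so the residue field is
    finite-dimensional and [place_degree] is its true dimension. *)
Lemma place_degree_basis Q : exists b : 'I_(place_degree Q) -> F,
  basis_mod iota [set z | z \in place_ring Q] [set z | place_ideal Q z] b.
Proof.
have [x x0 xI] := ideal_nontrivial Q.
have [N NP] := dependent_mod F_function_field x0 xI.
have [|n [b bP]] := basis_exists (place_subspace Q) (ideal_subspace Q) (N := N).
  move=> y /NP[c c0 cO]; exists c => //=.
  by rewrite -[X in place_ideal Q X](divfK x0) mulrC idealM.
exact: dim_mod_basis bP.
Qed.

Lemma place_degree_gt0 Q : (0 < place_degree Q)%N.
Proof.
have [b [_ _ bS]] := place_degree_basis Q.
rewrite lt0n; apply/eqP => d0.
have [c] := bS 1 (place1 Q); rewrite /= big1 => [|i _]; last first.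
  by exfalso; have := ltn_ord i; move: (nat_of_ord i) => k; rewrite d0.
by rewrite subr0 ideal1.
Qed.

(** The degree as the additive extension of [place_degree] to the free group; the sum over [dom]
    hides this additivity. *)
Definition degree_lift (D : {freeg place iota}) : int :=
  fglift (fun Q => (place_degree Q)%:Z : int^o) D.

Lemma degree_lift_additive : additive degree_lift.
Proof. exact: (@lift_is_additive _ _ int^o). Qed.

HB.instance Definition _ :=
  GRing.isAdditive.Build {freeg place iota} int degree_lift degree_lift_additive.

Lemma divisor_degreeE D : deg D = degree_lift D.
Proof.
rewrite -[in RHS](freeg_sumE D) raddf_sum /=.
by apply: eq_bigr => Q _; rewrite /degree_lift liftU.
Qed.

Lemma divisor_degreeD C D : deg (C + D) = deg C + deg D.
Proof. by rewrite !divisor_degreeE raddfD. Qed.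

Lemma divisor_degreeN D : deg (- D) = - deg D.
Proof. by rewrite !divisor_degreeE raddfN. Qed.

Lemma divisor_degreeMn D k : deg (D *+ k) = deg D *+ k.
Proof. by rewrite !divisor_degreeE raddfMn. Qed.

Lemma divisor_degree0 : deg 0 = 0.
Proof. by rewrite !divisor_degreeE raddf0. Qed.

Lemma divisor_degreeU k Q : deg << k *g Q >> = k * (place_degree Q)%:Z.
Proof. by rewrite divisor_degreeE /degree_lift liftU. Qed.

Lemma divisor_degree_sum (I : Type) (r : seq I) (G : I -> divisor iota) :
  deg (\sum_(i <- r) G i) = \sum_(i <- r) deg (G i).
Proof.
by rewrite divisor_degreeE raddf_sum; apply: eq_bigr => i _; rewrite divisor_degreeE.
Qed.

Lemma coeff_sum_uniq (s : seq (place iota)) (w : place iota -> int) Q : uniq s ->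
  coeff Q (\sum_(P <- s) << w P *g P >>) = if Q \in s then w Q else 0.
Proof.
elim: s => [|P s IH] /=; first by rewrite big_nil coeff0.
case/andP=> Ps us; rewrite big_cons coeffD coeffU IH // inE eq_sym.
have [->|] := eqVneq Q P; first by rewrite (negbTE Ps) mulr1 addr0.
by rewrite mulr0 add0r.
Qed.

(** Every place of the support contributes at least 1 to the degree, so there is only one, with
    coefficient and degree 1. *)
Lemma effective_degree1 B : (forall Q, 0 <= coeff Q B) -> deg B = 1 ->
  exists2 Q, B = << Q >> & place_degree Q = 1%N.
Proof.
move=> B0; rewrite /divisor_degree; case E: (dom B) => [|Q s]; first by rewrite big_nil.
have mQ : Q \in dom B by rewrite E mem_head.
have ge1 P : P \in dom B -> 1 <= coeff P B * (place_degree P)%:Z.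
  rewrite mem_dom => cP; have := B0 P; have := place_degree_gt0 P; nia.
rewrite big_cons; case: s E => [|P s] E; last first.
  rewrite big_cons => sum1; exfalso.
  have mP : P \in dom B by rewrite E !inE eqxx orbT.
  have sum0 : 0 <= \sum_(j <- s) coeff j B * (place_degree j)%:Z.
    by rewrite big_seq sumr_ge0 // => j _; rewrite mulr_ge0.
  have := lerD (ge1 Q mQ) (lerD (ge1 P mP) sum0).
  by rewrite sum1.
rewrite big_nil addr0 => sum1; have := B0 Q; have := place_degree_gt0 Q => dQ cQ.
have c1 : coeff Q B = 1 by nia.
exists Q; last by move: sum1; rewrite c1 mul1r; lia.
by rewrite -(freeg_sumE B) E big_seq1 c1.
Qed.

Lemma valuation_uniformizer Q t (m : int) : t != 0 -> valuation Q t = 1 ->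
  valuation Q (t ^ m) = m.
Proof.
move=> t0 vt; case: m => m.
  by rewrite valuationX // vt -mulr_natr mul1r natz.
rewrite NegzE -invr_expz valuationV ?expf_neq0 // valuationX // vt.
by rewrite -mulr_natr mul1r natz.
Qed.

(** This form treats f = 0 uniformly and lets closure under sums be inherited from the valuation
    rings. *)
Lemma riemann_rochP D f : RR D f <-> forall Q t, t != 0 -> valuation Q t = 1 ->
  f * t ^ coeff Q D \in place_ring Q.
Proof.
have [->|f0] := eqVneq f 0.
  by split=> [_ Q t _ _|_]; [rewrite mul0r place0 | left].
split=> [[fz|vf] Q t t0 vt|H]; first by rewrite fz eqxx in f0.
  rewrite -valuation_ge0 ?mulf_neq0 ?expfz_neq0 // valuationM ?expfz_neq0 //.
  by rewrite valuation_uniformizer // -lerBlDr sub0r.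
right=> Q; have [t t0 vt] := uniformizer_exists F_function_field Q.
have := H Q t t0 vt; rewrite -valuation_ge0 ?mulf_neq0 ?expfz_neq0 //.
by rewrite valuationM ?expfz_neq0 // valuation_uniformizer // -lerBlDr sub0r.
Qed.

Lemma riemann_roch_subspace D : subspace iota (RR D).
Proof.
split=> [|x y /riemann_rochP Hx /riemann_rochP Hy|c x /riemann_rochP Hx].
- by left.
- by apply/riemann_rochP => Q t t0 vt; rewrite mulrDl placeD ?Hx ?Hy.
- by apply/riemann_rochP => Q t t0 vt; rewrite -mulrA placeM ?place_const ?Hx.
Qed.

Lemma riemann_roch_mono C D : (forall Q, coeff Q C <= coeff Q D) ->
  forall f, RR C f -> RR D f.
Proof.
move=> CD f [->|vf]; [by left | right=> Q].
by apply: le_trans (vf Q); rewrite lerN2.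
Qed.

Lemma riemann_roch_mul D E f h : h != 0 ->
  (forall Q, coeff Q D - coeff Q E <= valuation Q h) -> RR D f -> RR E (f * h).
Proof.
move=> h0 vh; have [->|f0] := eqVneq f 0; first by rewrite mul0r; left.
case=> [/eqP|vf]; first by rewrite (negbTE f0).
by right=> Q; rewrite valuationM //; have := vf Q; have := vh Q; lia.
Qed.

(* [f |-> f * t ^ (coeff Q D + 1)] maps [RR (D + Q)] to [O_Q], and the elements
   sent into the maximal ideal are those of [RR D]. *)
Lemma dim_le_add_place D Q a : dim_le iota (RR D) [set 0] a ->
  dim_le iota (RR (D + << Q >>)) [set 0] (a + place_degree Q).
Proof.
move=> Da n y an Uy; set d := place_degree Q in an *.
have [b [bO bI bS]] := place_degree_basis Q; rewrite -/d in b bO bI bS.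
have [t t0 vt] := uniformizer_exists F_function_field Q.
pose k := coeff Q D + 1.
have coQ : coeff Q (D + << Q >>) = k by rewrite coeffD coeffU eqxx mulr1.
have yO i : y i * t ^ k \in place_ring Q.
  by rewrite -coQ; have /riemann_rochP := Uy i; apply.
have /fin_all_exists[A0 A0P] := fun i => bS _ (yO i).
pose A := \matrix_(i < n, j < d) A0 i j.
(* The rows of [M] are a basis of the relations among the residues of the y_i t^k. There are at
   least n - d > a of them, so the [g] below are more than a elements of [RR D]. *)
pose M := row_base (kermx A).
have MA : M *m A = 0 by apply/sub_kermxP; rewrite eq_row_base.
have aM : (a < \rank (kermx A))%N.
  by rewrite mxrank_ker; have := rank_leq_col A; lia.
pose g k := \sum_i iota (M k i) * y i.
have gI j : place_ideal Q (g j * t ^ k).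
  suff -> : g j * t ^ k =
      \sum_i iota (M j i) * (y i * t ^ k - \sum_l iota (A0 i l) * b l).
    exact: (subspace_comb _ (ideal_subspace Q)).
  under [RHS]eq_bigr do rewrite mulrBr.
  rewrite sumrB [X in _ = _ - X](_ : _ = 0) ?subr0; last first.
    under eq_bigr do rewrite mulr_sumr.
    rewrite exchange_big big1 // => l _.
    under eq_bigr do rewrite mulrA -rmorphM.
    rewrite -mulr_suml -rmorph_sum (_ : \sum_i _ = (M *m A) j l).
      by rewrite MA mxE rmorph0 mul0r.
    by rewrite mxE; apply: eq_bigr => i _; rewrite [A _ _]mxE.
  by rewrite mulr_suml; apply: eq_bigr => i _; rewrite mulrA.
have gL j : RR D (g j).
  have [g0|g0] := eqVneq (g j) 0; first by left.
  have [/eqP|vg] : RR (D + << Q >>) (g j).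
  - exact: (subspace_comb _ (riemann_roch_subspace _)).
  - by rewrite (negbTE g0).
  right=> P; have [->|PQ] := eqVneq P Q; last first.
    by have := vg P; rewrite coeffD coeffU eq_sym (negbTE PQ) mulr0 addr0.
  have := gI j; rewrite -valuation_gt0 ?mulf_neq0 ?expfz_neq0 //.
  by rewrite valuationM ?expfz_neq0 // valuation_uniformizer // /k; lia.
have [c [i0 ci0] cg] := Da _ g aM gL.
(* Since [M] has independent rows, a nontrivial relation between the [g] stays nontrivial in the
   y_i. *)
pose w := (\row_k c k) *m M.
exists (fun i => w 0 i).
  apply/rV0Pn; rewrite mulmx_free_eq0 ?row_base_free //.
  by apply/rV0Pn; exists i0; rewrite mxE.
move: cg => /= cg; rewrite -[RHS]cg /g; under [RHS]eq_bigr do rewrite mulr_sumr.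
rewrite exchange_big; apply: eq_bigr => i _.
rewrite mxE rmorph_sum mulr_suml; apply: eq_bigr => j _.
by rewrite mxE rmorphM mulrA.
Qed.

(** The divisor [B] is added one place at a time, each raising the bound by its degree. *)
Lemma dim_le_add_effective D B a (k : nat) : (forall Q, 0 <= coeff Q B) ->
  deg B = k%:Z -> dim_le iota (RR D) [set 0] a ->
  dim_le iota (RR (D + B)) [set 0] (a + k).
Proof.
move=> B0 Bk Da; pose w Q := `|coeff Q B|%N.
have wE Q : (w Q)%:Z = coeff Q B by rewrite gez0_abs.
have step1 C c Q m : dim_le iota (RR C) [set 0] c ->
    dim_le iota (RR (C + << Q >> *+ m)) [set 0] (c + m * place_degree Q).
  move=> Cc; elim: m => [|m IH]; first by rewrite mulr0n addr0 addn0.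
  by rewrite mulrSr addrA mulSnr addnA; apply: dim_le_add_place.
have step (s : seq (place iota)) : dim_le iota (RR (D + \sum_(Q <- s) << Q >> *+ w Q))
    [set 0] (a + \sum_(Q <- s) w Q * place_degree Q).
  elim: s => [|Q s IH]; first by rewrite !big_nil addr0 addn0.
  by rewrite !big_cons addrCA [_ + (_ + _)]addrC addnCA addnC; apply: step1.
have := step (dom B); congr (dim_le iota (RR (D + _)) _ (a + _)).
  rewrite -[RHS]freeg_sumE; apply: eq_bigr => Q _.
  by rewrite freegU_muln -wE natz.
apply/eqP; rewrite -eqz_nat -Bk /divisor_degree; apply/eqP.
rewrite (big_morph Posz PoszD (erefl _)); apply: eq_bigr => Q _.
by rewrite PoszM wE.
Qed.

End Divisors.

(** * Curves of genus one *)

Section GenusOne.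
Variables (K F : fieldType) (iota : {rmorphism K -> F}).
Hypothesis F_function_field : function_field iota.
Implicit Types (Q : place iota) (D C B : divisor iota) (f h : F).

Local Notation deg := (@divisor_degree _ _ iota).
Local Notation RR := (@riemann_roch_space _ _ iota).
Local Notation ell := (@riemann_roch_dim _ _ iota).

Hypothesis genus1 : has_genus iota 1.
Variable P0 : place iota.

Lemma riemann_inequality D : deg D <= (ell D)%:Z.
Proof. by have [_ /(_ D)] := genus1; lia. Qed.

(* Positive degree forces [ell D > 0], which rules out the junk value of
   [dim_mod] on infinite-dimensional spaces. *)
Lemma riemann_roch_finite D : exists N, dim_le iota (RR D) [set 0] N.
Proof.
(* The multiplicity |deg D| + 1 makes deg E positive, since P0 has degree at least 1. *)
pose E := D + << P0 >> *+ `|deg D|.+1.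
have degE : 0 < deg E.
  rewrite divisor_degreeD divisor_degreeMn divisor_degreeU mul1r -mulr_natr natz.
  by have := place_degree_gt0 F_function_field P0; nia.
have [|b [_ _ bS]] := @dim_mod_gt0 _ _ iota (RR E) [set 0].
  by have := riemann_inequality E; rewrite /riemann_roch_dim; lia.
exists (ell E) => n y nE yD.
apply: (spanning_dim_le (subspace_zero iota) bS nE) => i.
apply: riemann_roch_mono (yD i) => Q.
by rewrite coeffD coeffMn coeffU lerDl mulrn_wge0 // mul1r ler0n.
Qed.

Lemma riemann_roch_basis D : exists b : 'I_(ell D) -> F,
  basis_mod iota (RR D) [set 0] b.
Proof.
have [N DN] := riemann_roch_finite D.
have [|n [b bP]] := basis_exists (riemann_roch_subspace F_function_field D)
    (subspace_zero iota) (N := N); first by move=> y; apply: DN.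
exact: dim_mod_basis bP.
Qed.

Lemma riemann_roch_nonzero D : 0 < deg D -> exists2 f, f != 0 & RR D f.
Proof.
move=> D0; have [b [bD bi _]] := riemann_roch_basis D.
have lD : (0 < ell D)%N by have := riemann_inequality D; lia.
exists (b (Ordinal lD)) => //; apply/eqP => b0.
have := bi (fun i => (i == Ordinal lD)%:R).
rewrite /= big1 => [|i _]; last first.
  by have [->|_] := eqVneq i (Ordinal lD); rewrite ?b0 ?mulr0 // rmorph0 mul0r.
by move=> /(_ erefl (Ordinal lD))/eqP; rewrite eqxx oner_eq0.
Qed.

(* Multiplication by [h ^+ k] embeds [RR (k C)], of dimension at least
   [k * deg C], into the finite-dimensional space [RR 0]. *)
Lemma degree_le0 C h : h != 0 -> (forall Q, coeff Q C <= valuation Q h) ->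
  deg C <= 0.
Proof.
move=> h0 hC; rewrite leNgt; apply/negP => C0.
have [N DN] := riemann_roch_finite 0.
have [b [bC bi _]] := riemann_roch_basis (C *+ N.+1).
have lC : (N < ell (C *+ N.+1))%N.
  have := riemann_inequality (C *+ N.+1); rewrite divisor_degreeMn -mulr_natr natz.
  by nia.
have [|c [i ci] cb] := DN _ (fun i => b i * h ^+ N.+1) lC.
  move=> i; apply: riemann_roch_mul (bC i) => //; first exact: expf_neq0.
  by move=> Q; rewrite coeff0 subr0 coeffMn valuationX // lerMn2r hC orbT.
suff /bi cz : [set 0] (\sum_i iota (c i) * b i) by rewrite cz eqxx in ci.
apply/eqP; rewrite -(mulIr_eq0 _ (mulIf (expf_neq0 N.+1 h0))) mulr_suml.
by apply/eqP; rewrite -[RHS]cb; apply: eq_bigr => j _; rewrite mulrA.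
Qed.

(** The point is that (f) + D has finite support. By [degree_le0], its restriction to any finite set
    of places has degree at most deg D, so at most |deg D| places have positive coefficient, and a
    maximal set of them is the whole support. *)
Lemma residual_effective D f : f != 0 -> RR D f ->
  exists B, [/\ forall Q, coeff Q B = valuation Q f + coeff Q D,
                forall Q, 0 <= coeff Q B & deg B = deg D].
Proof.
move=> f0 [/eqP|vf]; first by rewrite (negbTE f0).
pose w Q := valuation Q f + coeff Q D.
have w0 Q : 0 <= w Q by have := vf Q; rewrite /w; lia.
pose B (s : seq (place iota)) : divisor iota := \sum_(Q <- s) << w Q *g Q >>.
have Bs s : uniq s -> deg (B s) <= deg D.
  move=> us; rewrite -subr_le0 -divisor_degreeN -divisor_degreeD.
  apply: (degree_le0 f0) => Q; rewrite coeffB coeff_sum_uniq //.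
  by case: ifP => _; rewrite ?addrK // sub0r.
pose p m := `[< exists s, [/\ uniq s, all (fun Q => 0 < w Q) s & size s = m] >].
have p0 : exists m, p m by exists 0%N; apply/asboolP; exists [::].
have pD m : p m -> (m <= `|deg D|)%N.
  case/asboolP=> s [us sw sm]; rewrite -lez_nat.
  apply: le_trans (ler_norm _); apply: le_trans (Bs s us); rewrite -sm.
  rewrite divisor_degree_sum -sum1_size (big_morph Posz PoszD (erefl _)).
  rewrite big_seq [leRHS]big_seq; apply: ler_sum => Q Qs.
  rewrite divisor_degreeU; have := allP sw Q Qs.
  by have := place_degree_gt0 F_function_field Q; nia.
case: (ex_maxnP p0 pD) => m /asboolP[s [us sw sm]] mmax.
have BE Q : coeff Q (B s) = w Q.
  rewrite coeff_sum_uniq //; case: ifPn => // Qs.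
  apply/eqP; rewrite eq_le w0 leNgt; apply/negP => wQ.
  suff /mmax : p m.+1 by rewrite ltnn.
  by apply/asboolP; exists (Q :: s); rewrite /= Qs wQ sm.
exists (B s); split=> // [Q|]; first by rewrite BE.
(* For the reverse inequality, D - B is the divisor of f^-1. *)
apply/le_anti; rewrite Bs //= -subr_le0 -divisor_degreeN -divisor_degreeD.
apply: (@degree_le0 _ f^-1); rewrite ?invr_eq0 // => Q.
by rewrite coeffB BE valuationV // /w opprD addrCA subrr addr0.
Qed.

End GenusOne.

(** * The unit lattice *)

Section UnitLattice.
Variables (K F : fieldType) (iota : {rmorphism K -> F}).
Hypothesis F_function_field : function_field iota.
Hypothesis genus1 : has_genus iota 1.
Variables (n : nat) (P : 'I_n -> place iota).
Hypothesis P_all : enumerates_rational_places P.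

Local Notation e i := (delta_mx 0 i : 'rV[int]_n).
Local Notation RR := (@riemann_roch_space _ _ iota).

Lemma unit_lattice_zmod : zmod_closed [pred x | `[< unit_lattice P x >]].
Proof.
split=> [|x y].
  apply/asboolP; exists 1.
    by split=> [|Q]; rewrite ?oner_neq0 // valuation1 // eqxx.
  by apply/rowP=> i; rewrite !mxE valuation1.
move=> /asboolP[f [f0 fP] <-] /asboolP[g [g0 gP] <-]; apply/asboolP.
have gV0 : g^-1 != 0 by rewrite invr_eq0.
exists (f / g); last first.
  by apply/rowP=> i; rewrite !mxE valuationM // valuationV.
split=> [|Q]; first by rewrite mulf_neq0.
rewrite valuationM // valuationV // subr_eq0 => vQ.
have [vf|/fP//] := eqVneq (valuation Q f) 0.
by apply: gP; rewrite eq_sym -vf.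
Qed.

Lemma degree_rational k i : divisor_degree << k *g P i >> = k.
Proof.
have [_ Prat] := P_all; have /Prat Pi : exists j, P i = P j by exists i.
by rewrite divisor_degreeU Pi mulr1.
Qed.

Lemma coeff_family (k : int) i j : coeff (P j) << k *g P i >> = k * (j == i)%:R.
Proof. by rewrite coeffU (inj_eq P_all.1) eq_sym. Qed.

Lemma coeff_outside (k : int) i Q : (forall j, Q <> P j) -> coeff Q << k *g P i >> = 0.
Proof.
by move=> QP; rewrite coeffU; case: eqP => [/esym/QP|]; rewrite // mulr0.
Qed.

(** The divisor of f is supported on the places P_i of degree one, so the sum is its degree;
    [degree_le0] applies to f and to f^-1. *)
Lemma unit_lattice_sum0 x : unit_lattice P x -> \sum_i x 0 i = 0.
Proof.
case=> f [f0 fP] <-.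
pose C : divisor iota := \sum_i << valuation (P i) f *g P i >>.
have CE Q : coeff Q C = valuation Q f.
  rewrite raddf_sum /=; have [[i ->]|QP] := pselect (exists i, Q = P i).
    rewrite (bigD1 i) //= coeff_family eqxx mulr1 big1 ?addr0 // => j ji.
    by rewrite coeff_family eq_sym (negbTE ji) mulr0.
  have -> : valuation Q f = 0.
    by apply/eqP; apply: contra_notT QP => /fP.
  by apply: big1 => i _; apply: coeff_outside => j QPj; apply: QP; exists j.
have -> : \sum_i valuation_vector P f 0 i = divisor_degree C.
  rewrite divisor_degree_sum; apply: eq_bigr => i _.
  by rewrite mxE degree_rational.
(* Without rational places the sum is empty, and there is no place to serve as [P0]. *)
have [n0|n0] := posnP n.
  by rewrite /C; move: (P); rewrite n0 => P'; rewrite big_ord0 divisor_degree0.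
pose P0 := P (Ordinal n0).
apply/le_anti/andP; split.
  by apply: (degree_le0 F_function_field genus1 P0 f0) => Q; rewrite CE.
rewrite -oppr_le0 -divisor_degreeN.
apply: (degree_le0 F_function_field genus1 P0 (h := f^-1)); first by rewrite invr_eq0.
by move=> Q; rewrite coeffN CE valuationV.
Qed.

(** A nonzero f in L(P_a + P_b - P_c) has an effective residual divisor of degree 1, which is a
    rational place P_d; then f^-1 has divisor P_a + P_b - P_c - P_d. *)
Lemma unit_lattice_quad a b c : exists d, unit_lattice P (quad a b c d).
Proof.
pose D : divisor iota := << P a >> + << P b >> - << P c >>.
have degD : divisor_degree D = 1.
  by rewrite !divisor_degreeD divisor_degreeN !degree_rational.
have [|f f0 fD] := @riemann_roch_nonzero _ _ _ F_function_field genus1 (P a) D.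
  by rewrite degD.
have [B [BE B0 BD]] := residual_effective F_function_field genus1 (P a) f0 fD.
have [|Q BQ Q1] := effective_degree1 F_function_field B0; first by rewrite BD.
have [_ Prat] := P_all; have /Prat[d Qd] := Q1; exists d.
have vE S : valuation S f^-1 = coeff S D - coeff S B.
  by rewrite BE valuationV // opprD addrCA subrr addr0.
rewrite {}BQ {}Qd in vE; exists f^-1; last first.
  apply/rowP=> i; rewrite mxE vE /D coeffB coeffD !coeff_family !mxE eqxx.
  by rewrite !mul1r.
split=> [|S]; first by rewrite invr_eq0.
rewrite vE; apply: contra_neqP => /forallNP SP.
by rewrite /D coeffB coeffD !coeff_outside.
Qed.

(* A function with divisor [P a - P b] would give [m + 1] independent elements
   [f ^+ i] of [RR (m (P b))], while the genus bounds its dimension by [m]. *)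
Lemma unit_lattice_inj a b : unit_lattice P (e a - e b) -> a = b.
Proof.
case=> f [f0 fP] fE; apply: contrapT => /eqP ab.
have vf i : valuation (P i) f = (i == a)%:R - (i == b)%:R.
  by have := congr1 (fun x : 'rV_n => x 0 i) fE; rewrite !mxE eqxx.
(* [D0] attains the genus, so l(D0) = deg D0, and m = l(D0) + 1 gives m P_b - D0 degree 1. A
   function z there satisfies (z) + m P_b = D0 + B with B effective of degree 1. *)
have [[D0 gD0] _] := genus1.
have D0l : divisor_degree D0 = (riemann_roch_dim D0)%:Z by lia.
pose m := (riemann_roch_dim D0).+1.
have [|z z0 zD] := @riemann_roch_nonzero _ _ _ F_function_field genus1 (P a)
    (<< P b >> *+ m - D0).
  rewrite divisor_degreeD divisor_degreeN divisor_degreeMn degree_rational D0l.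
  by rewrite /m natz intS addrK.
have [B [BE B0 BD]] := residual_effective F_function_field genus1 (P a) z0 zD.
have degB : divisor_degree B = 1.
  rewrite BD divisor_degreeD divisor_degreeN divisor_degreeMn degree_rational D0l.
  by rewrite /m natz intS addrK.
have [bD [_ _ bS]] := riemann_roch_basis F_function_field genus1 (P a) D0.
have := spanning_dim_le (subspace_zero iota) bS.
move=> /(dim_le_add_effective F_function_field (k := 1) B0 degB).
(* Multiplication by z^-1 carries L(m P_b) into L(D0 + B), of dimension at most l(D0) + 1 = m, which
   makes the m + 1 powers of f dependent. *)
rewrite addn1 -/m => /(_ m.+1 (fun i => z^-1 * f ^+ i) (leqnn _))[].
  move=> i; right=> Q; rewrite valuationM ?invr_eq0 ?expf_neq0 //.
  rewrite valuationV // valuationX //.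
  have : 0 <= coeff Q << P b >> *+ m + valuation Q f *+ i.
    have [[j ->]|QP] := pselect (exists j, Q = P j).
      rewrite coeff_family vf mul1r mulrnBl addrCA addr_ge0 ?mulrn_wge0 //.
      by rewrite subr_ge0 ler_wpMn2l // -ltnS.
    have -> : valuation Q f = 0.
      by apply/eqP; apply: contra_notT QP => /fP.
    rewrite coeff_outside ?mul0rn // => j QPj.
    by apply: QP; exists j.
  have := BE Q; rewrite coeffB coeffMn coeffD.
  move: (_ *+ m) (_ *+ i) (coeff Q B) (coeff Q D0) (valuation Q z).
  by clear=> *; lia.
move=> c c0 cz.
(* The function f has a pole at P_b, so its powers have strictly decreasing valuations there and no
   nontrivial combination vanishes. *)
have [|||i [u uU]] := @leading_term _ _ _ (P b) m (fun i => f ^+ i) c.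
- move=> i _; rewrite exprS invfM mulrCA divff ?expf_neq0 // mulr1.
  rewrite -valuation_gt0 ?invr_eq0 // valuationV // vf eqxx.
  by rewrite eq_sym (negbTE ab).
- by move=> i _; apply: expf_neq0.
- by [].
have -> : \sum_i iota (c i) * f ^+ i = 0.
  apply/eqP; rewrite -(mulrI_eq0 _ (mulfI (invr_neq0 z0))) mulr_sumr.
  by apply/eqP; rewrite -[RHS]cz; apply: eq_bigr => j _; rewrite mulrCA.
move/eqP; rewrite eq_sym mulf_eq0 (negbTE (place_unit_neq0 uU)) orbF.
by rewrite (negbTE (expf_neq0 _ f0)).
Qed.

End UnitLattice.

Theorem theorem1p1 (R : realType) (K : finFieldType) (F : fieldType)
    (iota : {rmorphism K -> F})
    (F_function_field : function_field iota)
    (K_full : full_constant_field iota)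
    (genus1 : has_genus iota 1)
    (n : nat) (P : 'I_n -> place iota)
    (P_all : enumerates_rational_places P)
    (n_ge5 : (5 <= n)%N) :
  unit_lattice P = generated_subgroup (minimal_vectors R (unit_lattice P)) /\
  well_rounded R (unit_lattice P).
Proof.
have LE : unit_lattice P = generated_subgroup (minimal_vectors R (unit_lattice P)).
  apply: quad_lattice_generated => //.
  - exact: unit_lattice_zmod.
  - exact: unit_lattice_sum0.
  - exact: unit_lattice_quad.
  - exact: unit_lattice_inj.
split=> //; apply: has_rank_generated => [x []//|x].
by rewrite -LE.
Qed.
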